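(* Let $A\in R(\Omega)$, with associated sequences $(a_n),(b_n),(c_n),(d_n)$ having limits $a,b,c,d$, and suppose that $A$ admits an involution kernel. Let $\alpha\in\mathbb N$ and $z\in\Omega$. (i) If $b_n=a_{n+1}=a$ for all $n\in\mathbb N$, then $A$ is symmetric relatively to $x'=0^\infty$. (ii) If for all $n\in\mathbb N$ $$\begin{cases} a_{\alpha+n+1}-a_{n+1}=d_{\alpha+n}-d_{\alpha+n+1}\\ b_n=a_{\alpha+1}+(d_{\alpha+1}-d_\alpha)=b\\ d_{\alpha+n}=d_\alpha+(b_1-a_{\alpha+1})+\sum_{j=2}^n(a_j-a_{\alpha+j})\\ d=d_\alpha+b-a_{\alpha+1}+\sum_{j=2}^\infty(a_j-a_{\alpha+j})\end{cases}$$ then $A$ is symmetric relatively to $x'=0^\alpha1z$. (iii) If $d_n=c_{n+1}=c$ for all $n\in\mathbb N$, then $A$ is symmetric relatively to $x'=1^\infty$. (iv) If for all $n\in\mathbb N$ $$\begin{cases} c_{\alpha+n+1}-c_{n+1}=b_{\alpha+n}-b_{\alpha+n+1}\\ d_n=c_{\alpha+1}+(b_{\alpha+1}-b_\alpha)=d\\ b_{\alpha+n}=b_\alpha+(d_1-c_{\alpha+1})+\sum_{j=2}^n(c_j-c_{\alpha+j})\\ b=b_\alpha+d-c_{\alpha+1}+\sum_{j=2}^\infty(c_j-c_{\alpha+j})\end{cases}$$ then $A$ is symmetric relatively to $x'=1^\alpha0z$.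
   Context: $\mathbb N=\{1,2,\dots\}$, $\Omega=\{0,1\}^{\mathbb N}$ with the product topology. $\Omega^-$ is a copy of $\Omega$ whose points are written $y=(y_1,y_2,\dots)$; $\hat\Omega=\Omega^-\times\Omega$, with points $(y|x)=(\dots,y_2,y_1|x_1,x_2,\dots)$. The Walters family $R(\Omega)$ is the set of continuous $A:\Omega\to\mathbb R$ for which there are convergent real sequences $(a_n),(b_n),(c_n),(d_n)$ such that for all $n\in\mathbb N$, $w\in\Omega$: $A(0^{n+1}1w)=a_{n+1}$, $A(01^n0w)=b_n$, $A(1^{n+1}0w)=c_{n+1}$, $A(10^n1w)=d_n$. The involution kernel of $A$ based at $x'\in\Omega$ is $W(y|x)=\sum_{n\ge1}[A(y_n,\dots,y_1,x_1,x_2,\dots)-A(y_n,\dots,y_1,x'_1,x'_2,\dots)]$, provided this series converges for every $(y|x)\in\hat\Omega$. ''$A$ admits an involution kernel'' means that it converges for every $(y|x)$ for some base point $x'$ (for $A\in R(\Omega)$ this condition does not depend on $x'$). The associated dual potential is $$A^*(y)=A(y_1,x_1,x_2,\dots)+W\big((y_2,y_3,\dots)\,|\,(y_1,x_1,x_2,\dots)\big)-W(y|x),$$ whose right-hand side does not depend on $x\in\Omega$. $A$ is symmetric relatively to $x'$ if the dual potential $A^*$ associated with the involution kernel based at $x'$ satisfies $A^*(y)=A(y_1,y_2,\dots)$ for all $y=(y_1,y_2,\dots)$. *)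

(* Defs.v *)
From mathcomp Require Import all_boot all_order all_algebra.
From mathcomp Require Import all_classical all_reals all_analysis.

Set Implicit Arguments.
Unset Strict Implicit.
Unset Printing Implicit Defensive.

Import Order.TTheory GRing.Theory Num.Theory numFieldNormedType.Exports.

Local Open Scope classical_set_scope.
Local Open Scope ring_scope.

(* Points of Omega are 0-based streams: the coordinate w_(i+1) is [w i], the
   symbols 0 and 1 are [false] and [true]. Omega^- is a copy of Omega, and a
   point (y|x) of Omega^- x Omega is passed as two arguments [y x]. *)
Definition Omega := cantor_space.

Definition prepend (s : seq bool) (w : Omega) : Omega :=
  fun i => if (i < size s)%N then nth false s i else w (i - size s)%N.

Definition shift (w : Omega) : Omega := fun i => w i.+1.

(* The infinite word sss... *)
Definition const_word (s : bool) : Omega := fun _ => s.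

(* Sequences indexed by {1, 2, ...} are functions on nat whose value at 0 is
   never used. *)
Definition walters_seqs (R : realType) (A : Omega -> R)
    (a_ b_ c_ d_ : nat -> R) : Prop :=
  forall (n : nat) (w : Omega), (1 <= n)%N ->
  [/\ A (prepend (nseq n.+1 false ++ [:: true]) w) = a_ n.+1,
      A (prepend (false :: nseq n true ++ [:: false]) w) = b_ n,
      A (prepend (nseq n.+1 true ++ [:: false]) w) = c_ n.+1 &
      A (prepend (true :: nseq n false ++ [:: true]) w) = d_ n].

Definition walters_family (R : realType) (A : Omega -> R) : Prop :=
  continuous A /\
  exists a_ b_ c_ d_ : nat -> R,
    [/\ cvgn a_, cvgn b_, cvgn c_ & cvgn d_] /\ walters_seqs A a_ b_ c_ d_.

(* The word y_n ... y_1 is [rev (mkseq y n)]. *)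
Definition kernel_term (R : realType) (A : Omega -> R) (x' y x : Omega)
    (n : nat) : R :=
  A (prepend (rev (mkseq y n)) x) - A (prepend (rev (mkseq y n)) x').

Definition kernel_sum (R : realType) (A : Omega -> R) (x' y x : Omega)
    (N : nat) : R :=
  \sum_(1 <= n < N.+1) kernel_term A x' y x n.

Definition has_involution_kernel_at (R : realType) (A : Omega -> R)
    (x' : Omega) : Prop :=
  forall y x : Omega, cvgn (kernel_sum A x' y x).

Definition admits_involution_kernel (R : realType) (A : Omega -> R) : Prop :=
  exists x' : Omega, has_involution_kernel_at A x'.

(* Meaningful only under [has_involution_kernel_at A x']. *)
Definition involution_kernel (R : realType) (A : Omega -> R)
    (x' y x : Omega) : R :=
  limn (kernel_sum A x' y x).

(* [B] is the dual potential of A for the kernel based at x'. The defining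
   formula is required for every x, since its value does not depend on x; this
   determines [B] uniquely. *)
Definition is_dual_potential (R : realType) (A : Omega -> R) (x' : Omega)
    (B : Omega -> R) : Prop :=
  has_involution_kernel_at A x' /\
  forall y x : Omega,
    B y = A (prepend [:: y 0%N] x)
          + involution_kernel A x' (shift y) (prepend [:: y 0%N] x)
          - involution_kernel A x' y x.

Definition symmetric_at (R : realType) (A : Omega -> R) (x' : Omega) : Prop :=
  exists2 B : Omega -> R,
    is_dual_potential A x' B & forall y : Omega, B y = A y.

(* Main.v *)
(* Let s be the first symbol of x' and t the other symbol. The terms depending
   on x telescope in the definition of the dual potential, so A^*(y) is the sum
   of A(y_1 x') and of A(y_(n+1)..y_1 x') - A(y_(n+1)..y_2 x') over n >= 1. On
   the Walters family A(w) is determined by the prefix of w that ends at its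
   first change of symbol w_m <> w_(m+1) with m >= 2, so the terms of this sum
   vanish once y has shown such a change (if it never does, use the continuity of
   A). Computing it along the first runs of y gives A(y) whenever A is constant
   on the cylinder [st] and
     A(s^k t x') - A(s^k x') = A(t s^k x') - A(t s^(k-1) x')   for all k >= 1.
   Both conditions are read off the hypotheses in each of the four cases. *)

Require Import Defs.
From mathcomp Require Import all_boot all_order all_algebra.
From mathcomp Require Import all_classical all_reals all_analysis.
From mathcomp Require Import ring zify.

Set Implicit Arguments.
Unset Strict Implicit.
Unset Printing Implicit Defensive.

Import Order.TTheory GRing.Theory Num.Theory numFieldNormedType.Exports.

Local Open Scope classical_set_scope.
Local Open Scope ring_scope.

Lemma cvg_prefix (w_ : nat -> Omega) (w : Omega) :
  (forall n i, (i < n)%N -> w_ n i = w i) -> w_ @ \oo --> w.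
Proof.
move=> Hw; apply/cvg_sup => i U [V] [[W] oW <-] WwN WU.
by apply: (filterS WU); rewrite nbhs_simpl; exists i.+1 => // n /= /Hw ->.
Qed.

Lemma continuous_prefix (R : realType) (A : Omega -> R) (w_ : nat -> Omega)
    (w : Omega) :
  continuous A -> (forall n i, (i < n)%N -> w_ n i = w i) ->
  A (w_ n) @[n --> \oo] --> A w.
Proof. by move=> cA /cvg_prefix w_w; exact: continuous_cvg (cA w) w_w. Qed.

(** Serves for words whose current run never ends: the Walters sequences do not list their value,
    but finite truncations of the run do. *)
Lemma eq_of_prefix_values (R : realType) (A : Omega -> R) (w : Omega) (v : R) :
  continuous A ->
  (forall n, exists2 w' : Omega, (forall i, (i < n)%N -> w' i = w i) & A w' = v) ->
  A w = v.
Proof.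
move=> cA Hw.
have [w_ w_w w_v] : exists2 w_ : nat -> Omega,
    (forall n i, (i < n)%N -> w_ n i = w i) & forall n, A (w_ n) = v.
  have [w_ Hw_] := choice (fun n => let: ex_intro2 w' p q := Hw n in
                           ex_intro (fun w' => _ /\ _) w' (conj p q)).
  by exists w_ => n; have [] := Hw_ n.
have := continuous_prefix cA w_w.
under eq_fun do rewrite w_v.
by move=> /(cvg_unique _ (cvg_cst v)) ->.
Qed.

(** * Finite words and runs *)

Lemma prepend_cat (s1 s2 : seq bool) (x : Omega) :
  prepend (s1 ++ s2) x = prepend s1 (prepend s2 x).
Proof.
apply/funext => i; rewrite /prepend size_cat nth_cat.
case: (ltnP i (size s1)) => [h1|h1]; first by rewrite ltn_addr.
by rewrite ltn_subLR // subnDA.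
Qed.

Lemma prepend_lt (s : seq bool) (x : Omega) (i : nat) :
  (i < size s)%N -> prepend s x i = nth false s i.
Proof. by rewrite /prepend => ->. Qed.

Lemma prepend_nseq_lt (n i : nat) (s : bool) (x : Omega) :
  (i < n)%N -> prepend (nseq n s) x i = s.
Proof. by move=> lt_in; rewrite prepend_lt ?size_nseq // nth_nseq lt_in. Qed.

Lemma prepend_nseq_ge (n i : nat) (s : bool) (x : Omega) :
  (n <= i)%N -> prepend (nseq n s) x i = x (i - n)%N.
Proof. by move=> le_ni; rewrite /prepend size_nseq ltnNge le_ni. Qed.

Lemma prepend_takeE (n : nat) (w : Omega) :
  w = prepend (mkseq w n) (fun i => w (i + n)%N).
Proof.
apply/funext => i; rewrite /prepend size_mkseq.
by case: ltnP => [lt_in|le_ni]; rewrite ?nth_mkseq ?subnK.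
Qed.

Lemma mkseq_const (y : nat -> bool) (n : nat) (s : bool) :
  (forall i, (i < n)%N -> y i = s) -> mkseq y n = nseq n s.
Proof.
move=> Hy; apply: (@eq_from_nth _ false); rewrite size_mkseq ?size_nseq //.
by move=> i lt_in; rewrite nth_mkseq // nth_nseq lt_in Hy.
Qed.

Lemma mkseqS_shift (y : Omega) (n : nat) :
  mkseq y n.+1 = y 0%N :: mkseq (Defs.shift y) n.
Proof.
by rewrite /mkseq /= -[1%N]addn0 iotaDl -map_comp; congr (_ :: _); exact: eq_map.
Qed.

Lemma prepend_rev_mkseqS (y : Omega) (n : nat) (x : Omega) :
  prepend (rev (mkseq y n.+1)) x
    = prepend (rev (mkseq (Defs.shift y) n)) (prepend [:: y 0%N] x).
Proof. by rewrite mkseqS_shift rev_cons -cats1 prepend_cat. Qed.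

(** Applied with [P i] saying that the symbol changes after [i]: the run starting at [l] is
    infinite, or it ends at a first [k]. *)
Lemma never_or_first (P : pred nat) (l : nat) :
  (forall i, (l <= i)%N -> ~~ P i) \/
  (exists2 k, (l <= k)%N && P k & forall i, (l <= i < k)%N -> ~~ P i).
Proof.
have [[k Pk]|nP] := pselect (exists k, (l <= k)%N && P k).
  right; have [m Pm mP] := ex_minnP (ex_intro (fun k => (l <= k)%N && P k) k Pk).
  exists m => // i /andP[le_li lt_im]; apply/negP => Pi.
  by have := mP i; rewrite le_li Pi => /(_ isT); rewrite leqNgt lt_im.
by left => i le_li; apply/negP => Pi; apply: nP; exists i; rewrite le_li.
Qed.

(** * Values of a Walters potential *)

Lemma walters_run (R : realType) (A : Omega -> R) (a_ b_ c_ d_ : nat -> R)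
    (s : bool) (n : nat) (w : Omega) :
  walters_seqs A a_ b_ c_ d_ -> (1 <= n)%N ->
  (forall i, (i <= n)%N -> w i = s) -> w n.+1 = ~~ s ->
  A w = (if s then c_ else a_) n.+1.
Proof.
move=> HA n1 Hw Hn; rewrite (prepend_takeE n.+2 w) -[n.+2]addn1.
rewrite /mkseq iotaD map_cat -/(mkseq w n.+1) (mkseq_const (s := s)) //= Hn.
by set x := (fun i => _); have [] := HA n x n1; case: (s).
Qed.

Lemma walters_switch (R : realType) (A : Omega -> R) (a_ b_ c_ d_ : nat -> R)
    (s : bool) (n : nat) (w : Omega) :
  walters_seqs A a_ b_ c_ d_ -> (1 <= n)%N ->
  w 0%N = s -> (forall i, (0 < i <= n)%N -> w i = ~~ s) -> w n.+1 = s ->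
  A w = (if s then d_ else b_) n.
Proof.
move=> HA n1 H0 Hw Hn; rewrite (prepend_takeE n.+2 w) mkseqS_shift H0 -[n.+1]addn1.
rewrite /mkseq iotaD map_cat -/(mkseq (Defs.shift w) n) (mkseq_const (s := ~~ s)); last first.
  by move=> i lt_in; apply: Hw; lia.
rewrite [map _ _]/= /Defs.shift add0n Hn.
by set x := (fun i => _); have [] := HA n x n1; case: (s).
Qed.

(** A change at [m = 0] is excluded, since the value then still depends on the length of the second
    run. The change at [m] may be a later one: the prefix up to [m.+1] contains the first. *)
Definition first_switch_determined (T : Type) (A : Omega -> T) : Prop :=
  forall (w w' : Omega) (m : nat), (1 <= m)%N -> w m != w m.+1 ->
    (forall i, (i <= m.+1)%N -> w i = w' i) -> A w = A w'.

Lemma eq_run (y : nat -> bool) (l n : nat) :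
  (forall i, (l <= i < n)%N -> ~~ (y i != y i.+1)) ->
  forall i, (l <= i <= n)%N -> y i = y l.
Proof.
move=> Hy; elim=> [|i IHi] /andP[li ni]; first by congr y; lia.
have [le_li|lt_il] := leqP l i; last by congr y; lia.
have := Hy i; rewrite le_li ni negbK => /(_ isT)/eqP <-.
by apply: IHi; rewrite le_li ltnW.
Qed.

(** If the first two symbols agree, the first run has length at least 2 and its length gives the
    value through [a_] or [c_]; otherwise the length of the second run does, through [b_] or [d_].
    The run in question ends at some [k <= m], inside the common prefix. *)
Lemma walters_first_switch (R : realType) (A : Omega -> R)
    (a_ b_ c_ d_ : nat -> R) :
  walters_seqs A a_ b_ c_ d_ -> first_switch_determined A.
Proof.
move=> HA w w' m m1 wm Hww'.
have [e01|n01] := eqVneq (w 0%N) (w 1%N).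
- have [/(_ m isT)|] := never_or_first (fun i => w i != w i.+1) 0; first by rewrite wm.
  move=> [k /andP[_ wk] Hk]; have {}Hk := @eq_run w 0 k Hk.
  have k1 : (1 <= k)%N by rewrite lt0n; apply: contraNneq wk => ->; rewrite e01.
  have km : (k <= m)%N.
    rewrite leqNgt; apply/negP => mk; move: wm.
    by rewrite (Hk m) ?(Hk m.+1) ?eqxx //; lia.
  have wkS : w k.+1 = ~~ w 0%N by move: wk; rewrite Hk ?leqnn //; do 2!case: (w _).
  rewrite (walters_run HA k1 (s := w 0%N)) //.
  rewrite (walters_run HA k1 (s := w 0%N) (w := w')) // => [i ik|].
    by rewrite -!Hww' ?Hk //; lia.
  by rewrite -!Hww' //; lia.
- have [/(_ m m1)|] := never_or_first (fun i => w i != w i.+1) 1; first by rewrite wm.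
  move=> [k /andP[k1 wk] Hk]; have {}Hk := @eq_run w 1 k Hk.
  have km : (k <= m)%N.
    rewrite leqNgt; apply/negP => mk; move: wm.
    by rewrite (Hk m) ?(Hk m.+1) ?eqxx //; lia.
  have w1 : w 1%N = ~~ w 0%N by move: n01; do 2!case: (w _).
  have wkS : w k.+1 = w 0%N.
    by move: wk; rewrite Hk ?leqnn ?k1 // w1; do 2!case: (w _).
  rewrite (walters_switch HA k1 (s := w 0%N)) // => [|i ik]; last by rewrite Hk.
  rewrite (walters_switch HA k1 (s := w 0%N) (w := w')) // => [|i ik|].
  - by rewrite -Hww'.
  - by rewrite -Hww' ?(Hk i) //; lia.
  - by rewrite -Hww' //; lia.
Qed.

(** * Partial sums of the dual potential *)

Lemma has_involution_kernel_at_any (R : realType) (A : Omega -> R) (x' : Omega) :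
  admits_involution_kernel A -> has_involution_kernel_at A x'.
Proof.
move=> [x0 K] y x.
(* If W is the kernel based at [x0], the one based at [x'] is W(y|x) - W(y|x'). *)
have -> : kernel_sum A x' y x
    = (fun N => kernel_sum A x0 y x N - kernel_sum A x0 y x' N).
  apply/funext => N; rewrite /kernel_sum -sumrB; apply: eq_bigr => n _.
  by rewrite /kernel_term; ring.
by apply: is_cvgB; exact: K.
Qed.

(* The partial sums of the dual potential, after the terms that depend on [x]
   have telescoped away. *)
Definition dual_sum (R : realType) (A : Omega -> R) (x' y : Omega) (N : nat) : R :=
  A (prepend [:: y 0%N] x')
    + \sum_(1 <= n < N.+1) (A (prepend (rev (mkseq y n.+1)) x')
                            - A (prepend (rev (mkseq (Defs.shift y) n)) x')).

Lemma dual_sumS (R : realType) (A : Omega -> R) (x' y : Omega) (N : nat) :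
  dual_sum A x' y N.+1 = dual_sum A x' y N
    + (A (prepend (rev (mkseq y N.+2)) x')
       - A (prepend (rev (mkseq (Defs.shift y) N.+1)) x')).
Proof. by rewrite /dual_sum big_nat_recr //= addrA. Qed.

(** Term [n] of the shifted kernel and term [n.+1] of the other evaluate [A] at the same word over
    [x], so these values cancel; hence the offset between [N] and [N.+1]. *)
Lemma dual_sumE (R : realType) (A : Omega -> R) (x' y x : Omega) (N : nat) :
  A (prepend [:: y 0%N] x) + kernel_sum A x' (Defs.shift y) (prepend [:: y 0%N] x) N
    - kernel_sum A x' y x N.+1 = dual_sum A x' y N.
Proof.
elim: N => [|N IHN].
  by rewrite /dual_sum /kernel_sum big_nat1 !big_geq // /kernel_term /mkseq /=; ring.
rewrite dual_sumS -IHN {1 2}/kernel_sum !(@big_nat_recr _ _ _ N.+1) //.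
rewrite (@big_nat_recr _ _ _ N.+2) //= -/(kernel_sum _ _ _ _ _).
rewrite -/(kernel_sum _ _ _ _ _) /kernel_term -prepend_rev_mkseqS.
by ring.
Qed.

Lemma symmetric_at_dual_sum (R : realType) (A : Omega -> R) (x' : Omega) :
  has_involution_kernel_at A x' ->
  (forall y, dual_sum A x' y @ \oo --> A y) -> symmetric_at A x'.
Proof.
move=> K HA; exists A => //; split=> // y x.
set x1 := prepend _ x.
have c1 : kernel_sum A x' (Defs.shift y) x1 @ \oo --> involution_kernel A x' (Defs.shift y) x1.
  exact: K.
have c2 : kernel_sum A x' y x N.+1 @[N --> \oo] --> involution_kernel A x' y x.
  by rewrite (@cvg_shiftS _ (kernel_sum A x' y x)); exact: K.
apply: (cvg_unique _ (HA y)) => //=.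
rewrite -(funext (dual_sumE A x' y x)).
exact: cvgB (cvgD (cvg_cst (A x1)) c1) c2.
Qed.

(** Inside the first run, term [n] is the value at s^(n+1) x' minus the value at s^n x', so the sum
    telescopes. *)
Lemma dual_sum_run (R : realType) (A : Omega -> R) (x' y : Omega) (s : bool) (N : nat) :
  (forall i, (i <= N)%N -> y i = s) ->
  dual_sum A x' y N = A (prepend (nseq N.+1 s) x').
Proof.
elim: N => [|N IHN] Hy; first by rewrite /dual_sum big_geq // addr0 Hy.
rewrite dual_sumS IHN => [|i iN]; last by apply: Hy; lia.
rewrite (mkseq_const (s := s)) // (mkseq_const (s := s)) => [|i iN]; last first.
  by apply: Hy; lia.
by rewrite !rev_nseq; ring.
Qed.

(* The two words compared in each further term agree past the switch. *)
Lemma dual_sum_stationary (R : realType) (A : Omega -> R) (x' y : Omega)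
    (k N : nat) :
  first_switch_determined A -> y k != y k.+1 -> (k = 0%N -> y 0%N = x' 0%N) ->
  (k < N)%N -> dual_sum A x' y N = dual_sum A x' y k.+1.
Proof.
move=> detA yk Hk; elim: N => // N IHN; rewrite ltnS leq_eqVlt => /orP[/eqP->//|kN].
rewrite dual_sumS IHN //; apply/eqP; rewrite addrC -subr_eq0 addrK subr_eq0; apply/eqP.
(* Reversal moves the change of [y] at [k] to position [N - k], which is positive because
   [k < N]. *)
apply: (detA _ _ (N - k)%N) => [||i iN]; first by lia.
  rewrite !prepend_lt ?size_rev ?size_mkseq; try lia.
  rewrite !nth_rev ?size_mkseq; try lia.
  rewrite !nth_mkseq; try lia.
  have -> : (N.+2 - (N - k).+1 = k.+1)%N by lia.
  have -> : (N.+2 - (N - k).+2 = k)%N by lia.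
  by rewrite eq_sym.
rewrite prepend_lt ?size_rev ?size_mkseq; last lia.
rewrite nth_rev ?size_mkseq ?nth_mkseq; try lia.
rewrite /prepend size_rev size_mkseq; case: ltnP => iN1.
  rewrite nth_rev ?size_mkseq ?nth_mkseq; try lia.
  by rewrite /Defs.shift; congr y; lia.
(* Position [N.+1] lies in the compared prefix only if [k = 0]; there the longer word shows [y 0]
   and the shorter one has already reached [x' 0]. *)
have -> : (N.+2 - i.+1 = 0)%N by lia.
have -> : (i - N.+1 = 0)%N by lia.
by rewrite Hk //; lia.
Qed.

(** * The symmetry criterion *)

Lemma symmetric_at_criterion (R : realType) (A : Omega -> R) (x' : Omega)
    (s : bool) :
  continuous A -> first_switch_determined A -> has_involution_kernel_at A x' ->
  x' 0%N = s ->
  (forall w w' : Omega, w 0%N = s -> w 1%N = ~~ s -> w' 0%N = s ->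
    w' 1%N = ~~ s -> A w = A w') ->
  (forall k, A (prepend (nseq k.+1 s) (prepend [:: ~~ s] x'))
             - A (prepend (nseq k.+1 s) x')
           = A (prepend (~~ s :: nseq k.+1 s) x')
             - A (prepend (~~ s :: nseq k s) x')) ->
  symmetric_at A x'.
Proof.
move=> cA detA K x'0 Ast Hcomm; apply: symmetric_at_dual_sum => // y.
have stop k v : y k != y k.+1 -> (k = 0%N -> y 0%N = x' 0%N) ->
    dual_sum A x' y k.+1 = v -> dual_sum A x' y @ \oo --> v.
  move=> yk Hk <-; apply: cvg_near_cst; exists k.+1 => // N /= kN.
  by rewrite (dual_sum_stationary detA yk).
have [yc|[k /andP[_ yk] Hk]] := never_or_first (fun i => y i != y i.+1) 0.
  have {}yc i : y i = y 0%N by apply: (@eq_run y 0 i) => [j _|]; rewrite ?yc ?leqnn.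
  rewrite (_ : dual_sum A x' y = fun N => A (prepend (nseq N.+1 (y 0%N)) x')).
    by apply: continuous_prefix => // n i ni; rewrite prepend_nseq_lt ?yc // ltnW.
  by apply/funext => N; apply: dual_sum_run.
have {}Hk i : (i <= k)%N -> y i = y 0%N by move=> ik; apply: (@eq_run y 0 k Hk).
have ykS : y k.+1 = ~~ y 0%N by move: yk; rewrite Hk //; do 2!case: (y _).
(* Write t for [~~ s]. If [y] begins with s^(k+1) t, the sum at [k.+1] is A(s^(k+1) x') + A(t
   s^(k+1) x') - A(t s^k x'), which [Hcomm] turns into A(s^(k+1) t x'). For [k = 0] this word and
   [y] lie in the cylinder [st]; otherwise they share the change at [k]. *)
have [y0|] := boolP (y 0%N == s).
  move/eqP in y0; apply: (stop k) => //; first by rewrite y0 x'0.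
  rewrite dual_sumS (dual_sum_run A x' Hk) mkseqS rev_rcons ykS.
  rewrite (mkseq_const (s := s)) => [|i ik]; last by rewrite Hk.
  rewrite mkseqS rev_rcons /(Defs.shift y k) ykS (mkseq_const (s := s)); last first.
    by move=> i ik; rewrite /Defs.shift Hk.
  rewrite !rev_nseq y0 -Hcomm addrC subrK.
  have [k0|k0] := posnP k.
    by subst k; apply: Ast; rewrite ?ykS ?y0.
  apply/esym/(detA _ _ k) => // i ik.
  have [ik'|ik'] := leqP i k; first by rewrite prepend_nseq_lt // Hk.
  have -> : i = k.+1 by lia.
  by rewrite prepend_nseq_ge // subnn ykS y0.
move=> y0; have {}y0 : y 0%N = ~~ s by move: y0; case: (y _); case: (s).
(* If [y] begins with ts, the change at 0 does not stop the sum, as [y 0] differs from [x' 0]. The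
   second run is followed instead: there [Hcomm] makes the terms telescope to A(t s^j x'). *)
have [k0|k0] := posnP k.
  subst k.
  have word j : (forall i, (0 < i <= j)%N -> y i = s) ->
      rev (mkseq y j.+1) = nseq j s ++ [:: ~~ s] /\
      rev (mkseq (Defs.shift y) j) = nseq j s.
    move=> Hj; rewrite mkseqS_shift y0 rev_cons -cats1.
    rewrite (mkseq_const (s := s)) ?rev_nseq // => i ij.
    by rewrite /Defs.shift Hj.
  have sum_word j : (forall i, (0 < i <= j)%N -> y i = s) ->
      dual_sum A x' y j = A (prepend (~~ s :: nseq j s) x').
    elim: j => [|j IHj] Hj; first by rewrite /dual_sum big_geq // addr0 y0.
    rewrite dual_sumS IHj => [|i ij]; last by apply: Hj; lia.
    have [-> ->] := word _ Hj.
    by rewrite prepend_cat Hcomm addrC subrK.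
  have [yc|[j /andP[j1 yj] Hj]] := never_or_first (fun i => y i != y i.+1) 1.
  - have {}yc i : (0 < i)%N -> y i = s.
      move=> i0; rewrite (@eq_run y 1 i) ?i0 ?leqnn //; first by rewrite ykS y0 negbK.
      by move=> m /andP[m1 _]; exact: yc.
    rewrite (_ : dual_sum A x' y = fun N => A (prepend (~~ s :: nseq N s) x')).
      apply: continuous_prefix => // n [|i] ni; first by rewrite prepend_lt.
      rewrite prepend_lt /= ?size_nseq; last by rewrite ltnS ltnW.
      by rewrite nth_nseq (ltnW ni) yc.
    by apply/funext => N; apply: sum_word => i /andP[i0 _]; exact: yc.
  - have {}Hj i : (0 < i <= j)%N -> y i = s.
      by move=> ij; rewrite (@eq_run y 1 j) // ykS y0 negbK.
    have yjS : y j.+1 = ~~ s.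
      by move: yj; rewrite Hj ?j1 ?leqnn //; case: (y _); case: (s).
    apply: (stop j) => //; first by move=> j0; rewrite j0 in j1.
    have [wj wj'] := word _ Hj.
    rewrite dual_sumS sum_word // mkseqS rev_rcons wj mkseqS rev_rcons wj'.
    rewrite /Defs.shift yjS addrC subrK.
    apply/esym/(detA _ _ j) => // -[|i] ij; first by rewrite prepend_lt.
    rewrite prepend_lt ?size_cat /= ?size_cat ?size_nseq ?addn1 // nth_cat size_nseq.
    have [ij'|ij'] := ltnP i j; first by rewrite nth_nseq ij' Hj.
    have -> : i = j by lia.
    by rewrite subnn.
apply: (stop k) => //; first by move=> k0'; rewrite k0' in k0.
rewrite dual_sumS (dual_sum_run A x' Hk) mkseqS rev_rcons ykS.
rewrite (mkseq_const (s := ~~ s)) => [|i ik]; last by rewrite Hk.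
rewrite mkseqS rev_rcons {1}/Defs.shift ykS (mkseq_const (s := ~~ s)); last first.
  by move=> i ik; rewrite /Defs.shift Hk.
(* Now [y] begins with t^(k+1) s and [k > 0]: the term crossing the switch compares two words of
   [st], hence vanishes. What remains is A(t^(k+1) x'), which equals A(y) because [x'] starts with
   s. *)
have Asts : A (prepend (s :: nseq k.+1 (~~ s)) x')
    = A (prepend (s :: nseq k (~~ s)) x').
  by apply: Ast; rewrite prepend_lt //= ?size_nseq ?nth_nseq ?k0.
rewrite !rev_nseq y0 negbK Asts subrr addr0.
apply/esym/(detA _ _ k) => // i ik.
have [ik'|ik'] := leqP i k; first by rewrite prepend_nseq_lt // Hk.
have -> : i = k.+1 by lia.
by rewrite prepend_nseq_ge // subnn ykS y0 x'0 negbK.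
Qed.

(** * The criterion in the four cases *)

Lemma switch_value_constant (R : realType) (A : Omega -> R)
    (a_ b_ c_ d_ : nat -> R) (s : bool) (v : R) (w : Omega) :
  continuous A -> walters_seqs A a_ b_ c_ d_ ->
  (forall n, (1 <= n)%N -> (if s then d_ else b_) n = v) ->
  w 0%N = s -> w 1%N = ~~ s -> A w = v.
Proof.
move=> cA HA Hv w0 w1.
have Hsw (u : Omega) n : u 0%N = s -> u n.+2 = s ->
    (forall i, (i <= n)%N -> u i.+1 = ~~ s) -> A u = v.
  move=> u0 un Hu; rewrite (walters_switch HA (n := n.+1) (s := s)) ?Hv //.
  by case=> // i /andP[_]; exact: Hu.
have [wc|[k /andP[k1 wk] Hk]] := never_or_first (fun i => w i != w i.+1) 1.
  have {}wc i : w i.+1 = ~~ s.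
    by rewrite (@eq_run w 1 i.+1) ?leqnn // => j /andP[j1 _]; exact: wc.
  apply: eq_of_prefix_values => // n.
  (* The only word of the cylinder left is s t^oo; writing s at position [n.+2] ends its second run
     beyond the prefix of length [n]. *)
  exists (fun i => if i == n.+2 then s else w i) => [i lt_in|].
    by case: eqVneq => // i_n; move: lt_in; lia.
  apply: (Hsw _ n) => //=; first by rewrite eqxx.
  by move=> i le_in; case: eqVneq => [|_]; [lia | exact: wc].
have {}Hk := @eq_run w 1 k Hk.
apply: (Hsw _ k.-1) => //.
  rewrite prednK //; move: wk.
  by rewrite Hk ?k1 ?leqnn // w1; case: (w _); case: (s).
by move=> i ik; rewrite Hk ?w1 //; lia.
Qed.

(** Here [A] is constant on the whole cylinder [s], and s^k x' = x'; both sides of the relation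
    required by the criterion are therefore 0. *)
Lemma symmetric_at_const_word (R : realType) (A : Omega -> R)
    (a_ b_ c_ d_ : nat -> R) (s : bool) (v : R) :
  continuous A -> walters_seqs A a_ b_ c_ d_ -> admits_involution_kernel A ->
  (forall n, (1 <= n)%N -> (if s then d_ else b_) n = v
                           /\ (if s then c_ else a_) n.+1 = v) ->
  symmetric_at A (const_word s).
Proof.
move=> cA HA K Hv.
have As w : w 0%N = s -> A w = v.
  move=> w0; have [w1|w1] := eqVneq (w 1%N) (~~ s).
    by apply: (switch_value_constant cA HA) w1 => // n /Hv[].
  have {}w1 : w 1%N = s by move: w1; case: (w _); case: (s).
  have Hrun (u : Omega) n : (forall i, (i <= n.+1)%N -> u i = s) ->
      u n.+2 = ~~ s -> A u = v.
    by move=> Hu un; rewrite (walters_run HA (n := n.+1) (s := s)) //; case: (Hv n.+1).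
  have [wc|[k /andP[_ wk] Hk]] := never_or_first (fun i => w i != w i.+1) 0.
    have {}wc i : w i = s.
      by rewrite -w0; apply: (@eq_run w 0 i) => [j _|]; rewrite ?wc ?leqnn.
    apply: eq_of_prefix_values => // n.
    exists (fun i => if i == n.+2 then ~~ s else w i) => [i lt_in|].
      by case: eqVneq => // i_n; move: lt_in; lia.
    apply: (Hrun _ n) => [i le_in|] /=; last by rewrite eqxx.
    by case: eqVneq => [|_]; [lia | exact: wc].
  have {}Hk i : (i <= k)%N -> w i = s by rewrite -w0 => ik; exact: (@eq_run w 0 k Hk).
  have k1 : (0 < k)%N by rewrite lt0n; apply: contraNneq wk => ->; rewrite w0 w1.
  apply: (Hrun _ k.-1); rewrite prednK //.
  by move: wk; rewrite Hk //; case: (w _); case: (s).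
apply: (@symmetric_at_criterion _ _ _ s) => //.
- exact: walters_first_switch HA.
- exact: has_involution_kernel_at_any.
- by move=> w w' w0 _ w'0 _; rewrite !As.
have sx n : prepend (nseq n s) (const_word s) = const_word s.
  by apply/funext => i; rewrite /prepend size_nseq nth_nseq; case: ltnP.
have tsx n : prepend (~~ s :: nseq n s) (const_word s)
    = prepend [:: ~~ s] (const_word s).
  by rewrite -[~~ s :: nseq n s]cat1s (prepend_cat [:: ~~ s] (nseq n s)) sx.
move=> k; rewrite (tsx k) (tsx k.+1) subrr sx [X in X - _]As ?prepend_nseq_lt //.
by rewrite As // subrr.
Qed.

(** With t = [~~ s], the initial s^alpha t of x' lengthens every run of s placed before it: A(s^k
    x') is [run_ (alpha + k)] for k >= 1, and A(t s^k x') is [coswitch_ (alpha + k)]. For k >= 2,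
    A(s^k t x') is [run_ k] and the relation of the criterion is the first equation; for k = 1 the
    word lies in [st] and the second equation applies. *)
Lemma symmetric_at_run_word (R : realType) (A : Omega -> R)
    (a_ b_ c_ d_ : nat -> R) (s : bool) (alpha : nat) (z : Omega)
    (run_ := if s then c_ else a_) (switch_ := if s then d_ else b_)
    (coswitch_ := if s then b_ else d_) :
  continuous A -> walters_seqs A a_ b_ c_ d_ -> admits_involution_kernel A ->
  (1 <= alpha)%N ->
  (forall n, (1 <= n)%N ->
     run_ (alpha + n + 1)%N - run_ n.+1
       = coswitch_ (alpha + n)%N - coswitch_ (alpha + n + 1)%N
     /\ switch_ n = run_ alpha.+1 + (coswitch_ alpha.+1 - coswitch_ alpha)) ->
  symmetric_at A (prepend (nseq alpha s ++ [:: ~~ s]) z).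
Proof.
move=> cA HA K alpha1 H; set x' := prepend _ z.
have x's i : (i < alpha)%N -> x' i = s.
  by move=> lt_i; rewrite /x' prepend_cat prepend_nseq_lt.
have x'alpha : x' alpha = ~~ s by rewrite /x' prepend_cat prepend_nseq_ge ?subnn.
have Ast w : w 0%N = s -> w 1%N = ~~ s ->
    A w = run_ alpha.+1 + (coswitch_ alpha.+1 - coswitch_ alpha).
  by move=> w0 w1; apply: (switch_value_constant cA HA) w1 => // n /H[].
have Arun k : A (prepend (nseq k.+1 s) x') = run_ (alpha + k.+1)%N.
  have -> : (alpha + k.+1 = (alpha + k).+1)%N by lia.
  apply: (walters_run HA (s := s)) => [|i le_i|]; first by lia.
    rewrite /prepend size_nseq nth_nseq; case: ltnP => // ik.
    by rewrite x's //; lia.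
  rewrite prepend_nseq_ge; last by lia.
  by have -> : ((alpha + k).+1 - k.+1 = alpha)%N by lia.
have Aco k : A (prepend (~~ s :: nseq k s) x') = coswitch_ (alpha + k)%N.
  rewrite -[~~ s :: _]/([:: ~~ s] ++ _) prepend_cat.
  have -> : coswitch_ = (if ~~ s then d_ else b_) by rewrite /coswitch_; case: (s).
  apply: (walters_switch HA (s := ~~ s)) => //; first by lia.
    move=> [|i] // le_i; rewrite /prepend /= subn1 /= size_nseq nth_nseq negbK.
    by case: ltnP => // ik; rewrite x's //; lia.
  rewrite {1}/prepend /= subn1 /= prepend_nseq_ge; last by lia.
  by rewrite addnK.
apply: (@symmetric_at_criterion _ _ _ s) => //.
- exact: walters_first_switch HA.
- exact: has_involution_kernel_at_any.
- exact: x's.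
- by move=> w w' w0 w1 w'0 w'1; rewrite !Ast.
move=> [|k]; rewrite Arun !Aco.
  by rewrite Ast // ?addn0 ?addn1 //; ring.
rewrite (walters_run HA (n := k.+1) (s := s)) //; last first.
- by rewrite prepend_nseq_ge ?subnn.
- by move=> i ik; rewrite prepend_nseq_lt.
have [] := H k.+1 isT; rewrite !addn1 addnS -/run_ => Hk _.
by rewrite !addnS -opprB -/run_ Hk opprB.
Qed.

Theorem theorem5p3 (R : realType) (A : Omega -> R)
    (a_ b_ c_ d_ : nat -> R) (a b c d : R) (alpha : nat) (z : Omega)
    (A_walters : walters_family A)
    (A_seqs : walters_seqs A a_ b_ c_ d_)
    (a_lim : a_ @ \oo --> a) (b_lim : b_ @ \oo --> b)
    (c_lim : c_ @ \oo --> c) (d_lim : d_ @ \oo --> d)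
    (A_kernel : admits_involution_kernel A)
    (alpha_ge1 : (1 <= alpha)%N) :
  [/\ (* (i) *)
      (forall n : nat, (1 <= n)%N -> b_ n = a_ n.+1 /\ a_ n.+1 = a) ->
        symmetric_at A (const_word false),
      (* (ii) *)
      (forall n : nat, (1 <= n)%N ->
         [/\ a_ (alpha + n + 1)%N - a_ n.+1
               = d_ (alpha + n)%N - d_ (alpha + n + 1)%N,
             b_ n = a_ alpha.+1 + (d_ alpha.+1 - d_ alpha) /\
             a_ alpha.+1 + (d_ alpha.+1 - d_ alpha) = b,
             d_ (alpha + n)%N = d_ alpha + (b_ 1%N - a_ alpha.+1)
               + \sum_(2 <= j < n.+1) (a_ j - a_ (alpha + j)%N) &
             d = d_ alpha + b - a_ alpha.+1
               + limn (fun m => \sum_(2 <= j < m) (a_ j - a_ (alpha + j)%N))]) ->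
        symmetric_at A (prepend (nseq alpha false ++ [:: true]) z),
      (* (iii) *)
      (forall n : nat, (1 <= n)%N -> d_ n = c_ n.+1 /\ c_ n.+1 = c) ->
        symmetric_at A (const_word true) &
      (* (iv) *)
      (forall n : nat, (1 <= n)%N ->
         [/\ c_ (alpha + n + 1)%N - c_ n.+1
               = b_ (alpha + n)%N - b_ (alpha + n + 1)%N,
             d_ n = c_ alpha.+1 + (b_ alpha.+1 - b_ alpha) /\
             c_ alpha.+1 + (b_ alpha.+1 - b_ alpha) = d,
             b_ (alpha + n)%N = b_ alpha + (d_ 1%N - c_ alpha.+1)
               + \sum_(2 <= j < n.+1) (c_ j - c_ (alpha + j)%N) &
             b = b_ alpha + d - c_ alpha.+1
               + limn (fun m => \sum_(2 <= j < m) (c_ j - c_ (alpha + j)%N))]) ->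
        symmetric_at A (prepend (nseq alpha true ++ [:: false]) z)].
Proof.
have cA : continuous A by case: A_walters.
(* Exchanging the two symbols swaps [a_] with [c_] and [b_] with [d_], so (iii) and (iv) are (i) and
   (ii) with s = [true]. *)
split=> H.
- by apply: (symmetric_at_const_word cA A_seqs A_kernel (v := a)) => n /H[-> ->].
- apply: (symmetric_at_run_word z cA A_seqs A_kernel (s := false) alpha_ge1).
  by move=> n /H[-> [-> _]].
- by apply: (symmetric_at_const_word cA A_seqs A_kernel (v := c)) => n /H[-> ->].
- apply: (symmetric_at_run_word z cA A_seqs A_kernel (s := true) alpha_ge1).
  by move=> n /H[-> [-> _]].
Qed.
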